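(* Consider the secure distributed linearly separable computation problem with $\mathsf K_{\rm c}=1$ and $\mathsf M=\frac{\mathsf K}{\mathsf N}(\mathsf N-\mathsf N_{\rm r}+1)$. Among secure schemes that use the cyclic assignment and achieve the optimal communication cost, the minimum randomness size is $\eta^\star_{\rm cyc}=\mathsf N_{\rm r}-1$.
   Context: Problem setting. $\mathsf K,\mathsf N,\mathsf N_{\rm r},\mathsf M$ are positive integers with $\mathsf N_{\rm r}\le \mathsf N$ and $\mathsf N$ dividing $\mathsf K$. Fix a prime power $\mathsf q$ (sufficiently large) and a positive integer $\mathsf L$. Datasets $D_1,\dots,D_{\mathsf K}$ are independent; message $W_k=f_k(D_k)\in\mathbb F_{\mathsf q}^{\mathsf L}$, with $W_1,\dots,W_{\mathsf K}$ mutually independent and uniform over $\mathbb F_{\mathsf q}^{\mathsf L}$. The user wants $W_1+\cdots+W_{\mathsf K}$. A secure scheme consists of an assignment $\mathcal Z_n\subseteq[\mathsf K]$, $|\mathcal Z_n|\le\mathsf M$; a random variable $Q$ on a finite set independent of the datasets, given to all servers but not the user; transmissions $X_n=\psi_n(\{W_k:k\in\mathcal Z_n\},Q)\in\mathbb F_{\mathsf q}^{\mathsf T_n}$; decodability from $\{X_n:n\in\mathcal A\}$ for every $\mathcal A\subseteq[\mathsf N]$, $|\mathcal A|=\mathsf N_{\rm r}$; security $I(W_1,\dots,W_{\mathsf K};X_1,\dots,X_{\mathsf N}\mid W_1+\cdots+W_{\mathsf K})=0$. Communication cost $\mathsf R=\max_{|\mathcal A|=\mathsf N_{\rm r}}\sum_{n\in\mathcal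 A}\mathsf T_n/\mathsf L$ (the optimal value over secure schemes is $\mathsf R^\star$); randomness size $\eta=H(Q)/\mathsf L$ ($\mathsf q$-ary units). Convention: $\mathrm{Mod}(b,a)\in\{1,\dots,a\}$ is the residue of $b$ modulo $a$, with $\mathrm{Mod}(b,a)=a$ when $a\mid b$. Cyclic assignment: for $i\in[\mathsf N]$ let $\mathcal G_i=\{k\in[\mathsf K]:\mathrm{Mod}(k,\mathsf N)=i\}$; server $n\in[\mathsf N]$ receives $\mathcal Z_n=\bigcup_{i\in\mathcal Z'_n}\mathcal G_i$ where $\mathcal Z'_n=\{\mathrm{Mod}(n,\mathsf N),\mathrm{Mod}(n+1,\mathsf N),\dots,\mathrm{Mod}(n+\mathsf N-\mathsf N_{\rm r},\mathsf N)\}$. *)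

(* Defs.v *)
From HB Require Import structures.
From mathcomp Require Import all_boot all_order all_algebra.
From mathcomp Require Import reals exp.
Set Implicit Arguments. Unset Strict Implicit. Unset Printing Implicit Defensive.
Import Order.TTheory GRing.Theory Num.Theory.
Local Open Scope ring_scope.

Definition Mod (b a : nat) : nat := if (a %| b)%N then a else (b %% a)%N.

Section Scheme.
Variables (R : realType) (F : finFieldType) (K N L : nat).

(* message tuple (W_1,...,W_K); index k : 'I_K stands for message k+1 *)
Definition msgs := {ffun 'I_K -> 'rV[F]_L}.

(* A (candidate) scheme: the type and pmf of the common randomness Q, the
   assignment Z_n, the transmission lengths T_n and the encoders psi_n.
   Server index n : 'I_N stands for server n+1. *)
Record scheme := Scheme {
  QT : finType;
  pQ : QT -> R;
  Zs : 'I_N -> {set 'I_K};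
  Tn : 'I_N -> nat;
  psi : forall n : 'I_N, msgs -> QT -> 'rV[F]_(Tn n) }.

Variable S : scheme.

(* sample space: (W_1..W_K, Q); W uniform over (F^L)^K, independent of Q ~ pQ *)
Definition Omega := (msgs * QT S)%type.
Definition Prob (w : Omega) : R := pQ w.2 / (#|F|%:R ^+ (K * L)).

Definition PrE (T : eqType) (X : Omega -> T) (x : T) : R :=
  \sum_(w : Omega | X w == x) Prob w.

Definition logq (x : R) : R := ln x / ln (#|F|%:R).

(* Shannon entropy H(X) = - sum_x P(X=x) log_q P(X=x) *)
Definition H (T : eqType) (X : Omega -> T) : R :=
  - \sum_(w : Omega) Prob w * logq (PrE X (X w)).

Definition pairRV (T U : eqType) (X : Omega -> T) (Y : Omega -> U) :=
  fun w => (X w, Y w).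

Definition Hcond (T U : eqType) (X : Omega -> T) (Y : Omega -> U) : R :=
  H (pairRV X Y) - H Y.

Definition Icond (T U V : eqType) (X : Omega -> T) (Y : Omega -> U)
    (Z : Omega -> V) : R :=
  H (pairRV X Z) + H (pairRV Y Z) - H (pairRV (pairRV X Y) Z) - H Z.

Definition Wall (w : Omega) : msgs := w.1.
Definition Qrv (w : Omega) : QT S := w.2.
Definition Wsum (w : Omega) : 'rV[F]_L := \sum_(k < K) w.1 k.
Definition Xn (n : 'I_N) (w : Omega) : seq F :=
  [seq psi n w.1 w.2 ord0 j | j <- enum 'I_(Tn S n)].
Definition XA (A : {set 'I_N}) (w : Omega) : {ffun 'I_N -> seq F} :=
  [ffun n => if n \in A then Xn n w else [::]].

Definition well_formed (M : nat) : Prop :=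
  [/\ (forall q : QT S, 0 <= pQ q),
      \sum_(q : QT S) pQ q = 1,
      (forall n, (#|Zs S n| <= M)%N) &
      (forall n (w w' : msgs) (q : QT S),
          (forall k, k \in Zs S n -> w k = w' k) -> psi n w q = psi n w' q)].

Definition decodable (Nr : nat) : Prop :=
  forall A : {set 'I_N}, #|A| = Nr -> Hcond Wsum (XA A) = 0.

Definition secure_cond : Prop :=
  Icond Wall (XA setT) Wsum = 0.

Definition secure_scheme (M Nr : nat) : Prop :=
  [/\ well_formed M, decodable Nr & secure_cond].

Definition comm_cost (Nr : nat) : R :=
  (\max_(A : {set 'I_N} | #|A| == Nr) \sum_(n in A) Tn S n)%N%:R / L%:R.

Definition rand_size : R := H Qrv / L%:R.

End Scheme.

(* cyclic assignment: Z_n = union of G_i for i in Z'_n, with 1-based indices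
   k+1 (messages) and n+1 (servers) *)
Definition cyclic_assignment (K N Nr : nat) (n : 'I_N) : {set 'I_K} :=
  [set k : 'I_K | [exists j : 'I_(N - Nr).+1,
       Mod k.+1 N == Mod (n.+1 + j) N]].

Definition uses_cyclic (R : realType) (F : finFieldType) (K N L Nr : nat)
    (S : scheme R F K N L) : Prop :=
  forall n, Zs S n = @cyclic_assignment K N Nr n.

Definition optimal_secure (R : realType) (F : finFieldType) (K N L M Nr : nat)
    (S : scheme R F K N L) : Prop :=
  secure_scheme S M Nr /\
  forall S' : scheme R F K N L, secure_scheme S' M Nr ->
    comm_cost S Nr <= comm_cost S' Nr.

(* Main.v *)
(* Converse. Decodability makes the sum a function of the answers of any N_r
   servers on outcomes of positive probability, so every message sits on at
   least N - N_r + 1 servers, and by counting on exactly that many. The N_r - 1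
   servers missing W_k together with one server n holding it then decode, so for
   fixed Q and fixed other messages X_n is injective in W_k: hence T_n >= L and
   the cost is at least N_r. Under the cyclic assignment, servers 1, .., N_r each
   hold a message missing from the earlier ones; by triangularity, for each q the
   fibers of W |-> X have at most q^((K - N_r) L) elements, so H(X) >= N_r L, and
   security turns this into H(Q) >= (N_r - 1) L.

   Achievability. Let d = N - N_r, and attach distinct points a_n of F to the
   servers. The coefficients of W_k in the answers are divided-difference weights
   on the d + 1 servers holding it: their moments sum_n a_n^j c_n vanish for
   j < d and equal 1 for j = d. The noise has vanishing moments for all j <= d,
   which leaves it N_r - 1 free vectors. Then the moments of (X_n) are 0 for
   j < d, so any N_r answers determine the others, and the d-th moment is the
   sum of the messages; given that sum, X is uniform. *)
Require Import Defs.
From HB Require Import structures.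
From mathcomp Require Import all_boot all_order all_algebra.
From mathcomp Require Import reals exp.

Set Implicit Arguments. Unset Strict Implicit. Unset Printing Implicit Defensive.
Import Order.TTheory GRing.Theory Num.Theory.
Local Open Scope ring_scope.

(** * Entropy of random variables on the sample space of a scheme *)

Section Entropy.
Variables (R : realType) (F : finFieldType) (K N L : nat).
Variable S : scheme R F K N L.
Hypothesis pQ_ge0 : forall q : QT S, 0 <= pQ q.
Hypothesis pQ_sum1 : \sum_(q : QT S) pQ q = 1.

Lemma card_F_gt0 : 0 < #|F|%:R :> R.
Proof. by rewrite ltr0n (ltn_trans _ (card_finNzRing_gt1 F)). Qed.

Lemma ln_card_F_gt0 : 0 < ln (#|F|%:R : R).
Proof. by apply: ln_gt0; rewrite ltr1n; exact: card_finNzRing_gt1. Qed.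

Lemma logq_le (x y : R) : 0 < x -> x <= y -> logq F x <= logq F y.
Proof.
move=> x0 xy; rewrite /logq ler_pM2r ?invr_gt0 ?ln_card_F_gt0 //.
by rewrite ler_ln ?posrE // (lt_le_trans x0).
Qed.

Lemma logq_XV (x : R) m : 0 < x -> logq F (x / #|F|%:R ^+ m) = logq F x - m%:R.
Proof.
move=> x0; rewrite /logq ln_div ?posrE ?exprn_gt0 ?card_F_gt0 //.
rewrite lnXn ?card_F_gt0 // mulrBl -[ln _ *+ m]mulr_natl mulfK //.
by rewrite gt_eqF ?ln_card_F_gt0.
Qed.

Lemma logq1 : logq F (1 : R) = 0.
Proof. by rewrite /logq ln1 mul0r. Qed.

Lemma card_msgs : #|msgs F K L| = (#|F| ^ (K * L))%N.
Proof. by rewrite card_ffun card_mx card_ord mul1n -expnM mulnC. Qed.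

Lemma Prob_ge0 (w : Omega S) : 0 <= Prob w.
Proof. by rewrite /Prob divr_ge0 ?exprn_ge0 ?ler0n. Qed.

(** Conditioning on [Q]: the messages are uniform and independent of it, so each probability reduces
    to counting message tuples for fixed q. *)
Lemma PrE_fiber (T : eqType) (X : Omega S -> T) (x : T) :
  PrE X x = \sum_q pQ q * #|[set w | X (w, q) == x]|%:R / #|F|%:R ^+ (K * L).
Proof.
rewrite /PrE big_mkcond /=.
pose G w q := if X (w, q) == x then Prob ((w, q) : Omega S) else 0.
rewrite (eq_bigr (fun p : Omega S => G p.1 p.2)) => [|[] //].
rewrite -(pair_bigA _ G) exchange_big /G /=.
apply: eq_bigr => q _; rewrite -big_mkcond /Prob /=.
rewrite sumr_const -[LHS]mulr_natr mulrAC; congr (_ * _%:R / _).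
by apply: eq_card => w; rewrite !inE.
Qed.

Lemma Prob_sum1 : \sum_(w : Omega S) Prob w = 1.
Proof.
have := PrE_fiber (fun=> tt) tt.
rewrite /PrE (eq_bigl xpredT) // => ->.
under eq_bigr => q _.
  rewrite (_ : [set w | _] = setT); last by apply/setP=> w; rewrite !inE.
  rewrite cardsT card_msgs natrX mulfK; last first.
    by rewrite expf_neq0 // gt_eqF ?card_F_gt0.
  over.
exact: pQ_sum1.
Qed.

Lemma PrE_le_sub (T U : eqType) (X : Omega S -> T) (Y : Omega S -> U) w :
  (forall w', Y w' = Y w -> X w' = X w) -> PrE Y (Y w) <= PrE X (X w).
Proof.
move=> YX; rewrite /PrE [leLHS]big_mkcond [leRHS]big_mkcond /=.
apply: ler_sum => w' _; case: eqP => [/YX ->|_]; first by rewrite eqxx.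
by case: ifP => _ //; exact: Prob_ge0.
Qed.

Lemma PrE_gt0 (T : eqType) (X : Omega S -> T) w : 0 < Prob w -> 0 < PrE X (X w).
Proof.
move=> w0; rewrite /PrE (bigD1 w) //= ltr_wpDr // sumr_ge0 // => w' _.
exact: Prob_ge0.
Qed.

Lemma Prob_sumM (f : Omega S -> R) (c : R) :
  (forall w, 0 < Prob w -> f w = c) -> \sum_(w : Omega S) Prob w * f w = c.
Proof.
move=> fc; rewrite -[RHS]mul1r -Prob_sum1 big_distrl /=.
apply: eq_bigr => w _; case: (ltrgtP 0 (Prob w)) (Prob_ge0 w) => // [w0|<-] _.
  by rewrite fc.
by rewrite !mul0r.
Qed.

Lemma Prob_sum_le (f g : Omega S -> R) :
  (forall w, 0 < Prob w -> f w <= g w) ->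
  \sum_(w : Omega S) Prob w * f w <= \sum_(w : Omega S) Prob w * g w.
Proof.
move=> fg; apply: ler_sum => w _.
case: (ltrgtP 0 (Prob w)) (Prob_ge0 w) => // [w0|<-] _.
  by rewrite ler_pM2l // fg.
by rewrite !mul0r.
Qed.

Lemma H_le (T U : eqType) (X : Omega S -> T) (Y : Omega S -> U) :
  (forall w, 0 < Prob w -> PrE Y (Y w) <= PrE X (X w)) -> H X <= H Y.
Proof.
move=> YX; rewrite /H lerN2; apply: Prob_sum_le => w w0.
by apply: logq_le (YX w w0); exact: PrE_gt0.
Qed.

Lemma H_le_sub (T U : eqType) (X : Omega S -> T) (Y : Omega S -> U) :
  (forall w w', Y w' = Y w -> X w' = X w) -> H X <= H Y.
Proof. by move=> YX; apply: H_le => w _; apply: PrE_le_sub => w'; apply: YX. Qed.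

(** Entropy depends only on the partition of the sample space that a variable induces. *)
Lemma H_equiv (T U : eqType) (X : Omega S -> T) (Y : Omega S -> U) :
  (forall w w', Y w' = Y w <-> X w' = X w) -> H X = H Y.
Proof.
by move=> YX; apply/le_anti/andP; split; apply: H_le_sub => w w' /YX.
Qed.

Lemma H_unif (T : eqType) (X : Omega S -> T) m :
  (forall w, PrE X (X w) = 1 / #|F|%:R ^+ m) -> H X = m%:R.
Proof.
move=> Xm; rewrite /H (@Prob_sumM _ (- m%:R)) ?opprK // => w _.
by rewrite Xm logq_XV ?ltr01 // logq1 sub0r.
Qed.

Lemma H_ge (T : eqType) (X : Omega S -> T) m :
  (forall w, 0 < Prob w -> PrE X (X w) <= 1 / #|F|%:R ^+ m) -> m%:R <= H X.
Proof.
move=> Xm; rewrite /H lerNr -(@Prob_sumM (fun=> - m%:R) (- m%:R)) //.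
apply: Prob_sum_le => w w0; rewrite -[leRHS]add0r -logq1 -logq_XV ?ltr01 //.
by apply: logq_le (Xm w w0); exact: PrE_gt0.
Qed.

Lemma PrE_id (w : Omega S) : PrE id w = Prob w.
Proof. by rewrite /PrE big_pred1_eq. Qed.

Lemma cardF_expn_neq0 m : #|F|%:R ^+ m != 0 :> R.
Proof. by rewrite expf_neq0 // gt_eqF ?card_F_gt0. Qed.

Lemma PrE_Qrv (q : QT S) : PrE (@Qrv _ _ _ _ _ S) q = pQ q.
Proof.
rewrite PrE_fiber (bigD1 q) //= big1 ?addr0 => [|q' q'q]; last first.
  rewrite (_ : [set w | _] = set0) ?cards0 ?mulr0 ?mul0r //.
  by apply/setP => w; rewrite !inE /Qrv /= (negbTE q'q).
rewrite (_ : [set w | _] = setT) ?cardsT ?card_msgs ?natrX ?mulfK ?cardF_expn_neq0 //.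
by apply/setP => w; rewrite !inE /Qrv /= eqxx.
Qed.

(** The identity is the pair (W, Q), whose independent components have additive entropies. *)
Lemma H_msgs_Q : H (@id (Omega S)) = (K * L)%:R + H (@Qrv _ _ _ _ _ S).
Proof.
rewrite /H -[(K * L)%:R]opprK -opprD; congr (- _).
rewrite -(@Prob_sumM (fun=> - (K * L)%:R) (- (K * L)%:R)) // -big_split /=.
apply: eq_bigr => w _.
case: (ltrgtP 0 (Prob w)) (Prob_ge0 w) => // [w0|<-] _; last by rewrite !mul0r addr0.
rewrite -mulrDr; congr (_ * _); rewrite PrE_id PrE_Qrv addrC -logq_XV //.
by rewrite -PrE_Qrv; apply: PrE_gt0.
Qed.

Lemma PrE_msgs (T : eqType) (f : msgs F K L -> T) (x : T) :
  PrE (fun w : Omega S => f w.1) x = #|[set w | f w == x]|%:R / #|F|%:R ^+ (K * L).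
Proof.
rewrite PrE_fiber /= -mulr_suml -mulr_suml pQ_sum1 mul1r //.
Qed.

Lemma H_Wall : H (@Wall _ _ _ _ _ S) = (K * L)%:R.
Proof.
apply: H_unif => w; rewrite [LHS](PrE_msgs id) (_ : [set w | _] = [set w.1]) ?cards1 //.
by apply/setP => w'; rewrite !inE.
Qed.

(** Translating one coordinate carries any fiber of the sum injectively into any other, so all q^L
    fibers have equal size. *)
Lemma card_sum_fiber (s : 'rV[F]_L) : (0 < K)%N ->
  #|[set w : msgs F K L | \sum_k w k == s]| = (#|F| ^ (K.-1 * L))%N.
Proof.
move=> K0; pose k0 := Ordinal K0.
pose E s := [set w : msgs F K L | \sum_k w k == s].
pose tr t (w : msgs F K L) : msgs F K L := [ffun k => if k == k0 then w k + t else w k].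
have trK t : cancel (tr t) (tr (- t)).
  by move=> w; apply/ffunP => k; rewrite !ffunE; case: eqP => //; rewrite addrK.
have sum_tr t w : \sum_k tr t w k = \sum_k w k + t.
  rewrite (bigD1 k0) //= [X in _ = X + _](bigD1 k0) //= ffunE eqxx addrAC; congr (_ + _ + _).
  by apply: eq_bigr => k /negbTE kk; rewrite ffunE kk.
have le_E s1 s2 : (#|E s1| <= #|E s2|)%N.
  rewrite -(card_imset _ (can_inj (trK (s2 - s1)))); apply: subset_leq_card.
  apply/subsetP => _ /imsetP[w + ->]; rewrite !inE => /eqP ws.
  by rewrite sum_tr ws addrC subrK.
have cE s' : #|E s'| = #|E s| by apply/eqP; rewrite eqn_leq !le_E.
have : #|msgs F K L| = (\sum_(s : 'rV[F]_L) #|E s|)%N.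
  rewrite -sum1_card (partition_big (fun w : msgs F K L => \sum_k w k) xpredT) //=.
  by apply: eq_bigr => s' _; rewrite -sum1_card; apply: eq_bigl => w; rewrite inE.
rewrite card_msgs; under eq_bigr do rewrite cE.
rewrite sum_nat_const card_mx mul1n -{1}(prednK K0) mulSn expnD => /eqP.
by rewrite eqn_pmul2l ?expn_gt0 ?(ltn_trans _ (card_finNzRing_gt1 F)) // => /eqP.
Qed.

Lemma H_Wsum : (0 < K)%N -> H (@Wsum _ _ _ _ _ S) = L%:R.
Proof.
move=> K0; apply: H_unif => w.
rewrite [LHS](PrE_msgs (fun w => \sum_k w k)) card_sum_fiber // natrX.
rewrite -{2}(prednK K0) mulSn exprD div1r invfM mulrCA mulfV ?mulr1 //.
exact: cardF_expn_neq0.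
Qed.

(** H(X,Y) - H(Y) is a sum of nonnegative terms, so each one vanishes, and on the support the events
    fixing (X,Y) and fixing Y alone are equally likely. *)
Lemma Hcond0_determined (T U : eqType) (X : Omega S -> T) (Y : Omega S -> U) :
  Hcond X Y = 0 -> forall w w', 0 < Prob w -> 0 < Prob w' -> Y w = Y w' -> X w = X w'.
Proof.
move=> /eqP; rewrite /Hcond /H subr_eq0 eqr_opp eq_sym -subr_eq0 -sumrB => /eqP h w w' w0 w'0 Yww'.
pose f w := Prob w * logq F (PrE Y (Y w)) - Prob w * logq F (PrE (pairRV X Y) (pairRV X Y w)).
have f_ge0 v : 0 <= f v.
  rewrite /f -mulrBr; case: (ltrgtP 0 (Prob v)) (Prob_ge0 v) => // [v0|<-] _; last by rewrite mul0r.
  rewrite mulr_ge0 ?Prob_ge0 // subr_ge0; apply: logq_le; first exact: PrE_gt0.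
  by apply: PrE_le_sub => v' [].
have : f w == 0.
  move/eqP: h; rewrite psumr_eq0 => [/allP hf|v _]; last exact: f_ge0.
  by have := hf w (mem_index_enum w); rewrite implyTb.
have lnF0 : (ln #|F|%:R : R)^-1 != 0 by rewrite invr_eq0 gt_eqF ?ln_card_F_gt0.
rewrite /f -mulrBr mulf_eq0 gt_eqF //= subr_eq0 /logq => /eqP/(mulIf lnF0).
move=> /ln_inj; rewrite !posrE !PrE_gt0 // => /(_ isT isT).
apply: contra_eq => XX'; rewrite eq_sym lt_eqF //.
(* If X differed at w', the positive mass of w' would make the event fixing Y strictly likelier. *)
rewrite /PrE [ltRHS](bigID (fun v => X v == X w)) /=.
have -> : \sum_(v | pairRV X Y v == pairRV X Y w) Prob v =
    \sum_(v | (Y v == Y w) && (X v == X w)) Prob v.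
  by apply: eq_bigl => v; rewrite [LHS]xpair_eqE andbC.
rewrite ltrDl (bigD1 w') /= ?Yww' ?eqxx 1?eq_sym //.
rewrite ltr_wpDr // sumr_ge0 // => v _; exact: Prob_ge0.
Qed.

End Entropy.

(** * Lower bounds *)

Lemma XA_eqP (R : realType) (F : finFieldType) (K N L : nat)
    (S : scheme R F K N L) (A : {set 'I_N}) (x y : Omega S) :
  XA A x = XA A y <-> {in A, forall n, psi n x.1 x.2 = psi n y.1 y.2}.
Proof.
split=> [/ffunP XAxy n nA | xy].
  have := XAxy n; rewrite !ffunE nA => /eq_in_map eqxy.
  by apply/rowP => j; apply: eqxy; rewrite mem_enum.
by apply/ffunP => n; rewrite !ffunE; case: ifP => // nA; rewrite /Xn xy.
Qed.

Section Converse.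
Variables (R : realType) (F : finFieldType) (K N L M Nr : nat).
Variable S : scheme R F K N L.
Hypothesis wfS : well_formed S M.
Hypothesis decS : decodable S Nr.

Definition servers (k : 'I_K) : {set 'I_N} := [set n | k \in Zs S n].

Lemma pQ_pos : exists q : QT S, 0 < pQ q.
Proof.
case: wfS => pge0 psum1 _ _.
have /existsP[q] : [exists q : QT S, 0 < pQ q]; last by exists q.
apply: contra_eqT psum1 => /existsPn np.
rewrite big1 1?eq_sym ?oner_eq0 // => q _; apply/le_anti.
by rewrite pge0 leNgt np.
Qed.

(** Passes from entropies to a combinatorial statement: for q of positive mass, every outcome (w, q)
    has positive probability. *)
Lemma decode_sum (A : {set 'I_N}) (w w' : msgs F K L) (q : QT S) :
  #|A| = Nr -> 0 < pQ q -> {in A, forall n, psi n w q = psi n w' q} ->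
  \sum_k w k = \sum_k w' k.
Proof.
case: wfS => pge0 psum1 _ _ cA q0 Aww'.
have P0 v : 0 < Prob ((v, q) : Omega S) by rewrite divr_gt0 ?exprn_gt0 ?card_F_gt0.
apply: (Hcond0_determined pge0 (decS cA) (P0 w) (P0 w')).
exact/XA_eqP.
Qed.

Lemma sum_eq_off (w w' : msgs F K L) k :
  (forall j, j != k -> w j = w' j) -> \sum_j w j = \sum_j w' j -> w = w'.
Proof.
move=> ww'; rewrite (bigD1 k) //= [X in _ = X](bigD1 k) //=.
rewrite (eq_bigr w') => [/addIr wk|j /ww' //].
by apply/ffunP => j; have [->|/ww'] := eqVneq j k.
Qed.

Lemma servers_gt k : (Nr <= N)%N -> (0 < L)%N -> (N - Nr < #|servers k|)%N.
Proof.
move=> leNr L0; rewrite ltnNge; apply/negP => le_s.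
have : (Nr <= #|~: servers k|)%N.
  by rewrite cardsCs setCK card_ord leq_subRL ?(leq_trans le_s) ?leq_subr // addnC -leq_subRL.
case/card_geqP => s [us ss sk]; case: pQ_pos => q q0.
(* Two tuples differing only in W_k look the same to N_r servers without W_k, yet have different
   sums. *)
pose w : msgs F K L := [ffun=> 0].
pose w' : msgs F K L := [ffun j => if j == k then const_mx 1 else 0].
have ww' : w = w'.
  apply: (@sum_eq_off _ _ k) => [j jk|]; first by rewrite !ffunE (negbTE jk).
  apply: (@decode_sum [set x in s] _ _ q) => //.
    by rewrite cardsE (card_uniqP us).
  move=> n; rewrite inE => /sk; rewrite !inE => kn.
  case: wfS => _ _ _; apply=> j jn; rewrite !ffunE; case: eqP => // jk.
  by rewrite -jk jn in kn.
have := congr1 (fun v : msgs F K L => v k ord0 (Ordinal L0)) ww'.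
by rewrite !ffunE eqxx !mxE => /esym/eqP; rewrite oner_eq0.
Qed.

Lemma sum_servers : (\sum_k #|servers k| = \sum_n #|Zs S n|)%N.
Proof.
under eq_bigr do rewrite -sum1_card big_mkcond /=.
rewrite exchange_big; apply: eq_bigr => n _ /=.
by rewrite -sum1_card [RHS]big_mkcond; apply: eq_bigr => k _; rewrite inE.
Qed.

Hypothesis leNr : (Nr <= N)%N.
Hypothesis L0 : (0 < L)%N.
Hypothesis Nr0 : (0 < Nr)%N.
Hypothesis tightM : (K * (N - Nr).+1 = N * M)%N.

(** Double counting: at least N - N_r + 1 servers per message, at most M messages per server, and
    [tightM] equates the two totals. *)
Lemma sum_Zs : (\sum_n #|Zs S n| = N * M)%N.
Proof.
have cst m c : (m * c = \sum_(i < m) c)%N by rewrite sum_nat_const card_ord.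
case: wfS => _ _ ZM _; apply/eqP; rewrite eqn_leq; apply/andP; split.
  by rewrite cst; apply: leq_sum.
rewrite -tightM -sum_servers cst.
by apply: leq_sum => k _; rewrite servers_gt.
Qed.

(** Termwise inequalities whose sums agree are equalities in every term. *)
Lemma card_servers k : #|servers k| = (N - Nr).+1.
Proof.
have := @leqif_sum _ xpredT (fun k => (N - Nr).+1 == #|servers k|)
  (fun=> (N - Nr).+1) (fun k => #|servers k|).
case=> [j _|_]; first by split; rewrite // servers_gt.
rewrite sum_nat_const card_ord sum_servers sum_Zs tightM eqxx => /esym/forall_inP.
by move=> /(_ k isT)/eqP.
Qed.

Lemma card_Zs n : #|Zs S n| = M.
Proof.
case: wfS => _ _ ZM _.
have := @leqif_sum _ xpredT (fun n => #|Zs S n| == M)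
  (fun n => #|Zs S n|) (fun=> M).
case=> [j _|_]; first by split.
rewrite sum_nat_const card_ord sum_Zs eqxx => /esym/forall_inP.
by move=> /(_ n isT)/eqP.
Qed.

(* The N_r - 1 servers without W_k together with server n form a decoding
   set in which only server n depends on W_k. *)
Lemma psi_inj k n (w w' : msgs F K L) (q : QT S) :
  k \in Zs S n -> 0 < pQ q -> (forall j, j != k -> w j = w' j) ->
  psi n w q = psi n w' q -> w = w'.
Proof.
move=> kn q0 ww' eq_psi; apply: (sum_eq_off ww').
apply: (@decode_sum (n |: ~: servers k) _ _ q) => //.
  rewrite cardsU1 !inE kn /= [#|_|]cardsCs setCK card_servers card_ord.
  by rewrite subnS subKn // add1n prednK.
move=> m; rewrite !inE => /predU1P[->//|km].
case: wfS => _ _ _; apply=> j jm; apply: ww'; apply: contraNneq km => <- //.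
Qed.

(** Since M > 0, server n holds some message; varying it alone injects F^L into F^(T_n). *)
Lemma Tn_ge n : (0 < M)%N -> (L <= Tn S n)%N.
Proof.
rewrite -(card_Zs n) => /card_gt0P[k kn]; case: pQ_pos => q q0.
pose w v : msgs F K L := [ffun j => if j == k then v else 0].
have inj_w : injective (fun v => psi n (w v) q).
  move=> v v' /(psi_inj kn q0) wvv'; have /ffunP/(_ k) : w v = w v'.
    by apply: wvv' => j jk; rewrite !ffunE (negbTE jk).
  by rewrite !ffunE eqxx.
have := leq_card _ inj_w; rewrite !card_mx !mul1n leq_exp2l //.
exact: card_finNzRing_gt1.
Qed.

Lemma comm_cost_ge : (0 < M)%N -> Nr%:R <= comm_cost S Nr.
Proof.
move=> M0; rewrite /comm_cost ler_pdivlMr ?ltr0n // -natrM ler_nat.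
have [|s [us ss _]] := @card_geqP _ [set: 'I_N] Nr _.
  by rewrite cardsT card_ord.
have cA : #|[set x in s]| == Nr by rewrite cardsE (card_uniqP us) ss.
apply: leq_trans (leq_bigmax_cond _ cA).
by rewrite -[in (Nr * L)%N](eqP cA) -sum_nat_const; apply: leq_sum => n _; rewrite Tn_ge.
Qed.

(** * Entropy of the answers along a triangular chain of servers *)

Section Chain.
Variables (r : nat) (s : 'I_r -> 'I_N) (kap : 'I_r -> 'I_K).
Hypothesis kap_in : forall i, kap i \in Zs S (s i).
Hypothesis kap_out : forall i j : 'I_r, (j < i)%N -> kap i \notin Zs S (s j).

Lemma kap_inj : injective kap.
Proof.
move=> i j eq_ij; apply/val_inj; case: (ltngtP i j) => // lt_ij.
  by have := kap_out lt_ij; rewrite -eq_ij kap_in.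
by have := kap_out lt_ij; rewrite eq_ij kap_in.
Qed.

(** Among the chain messages, server [s i] holds none after [kap i]. Once the earlier ones are known
    to agree, its answer fixes [kap i] by [psi_inj]. *)
Lemma psi_chain_inj (w w' : msgs F K L) (q : QT S) :
  0 < pQ q -> (forall k, k \notin codom kap -> w k = w' k) ->
  (forall n, psi n w q = psi n w' q) -> w = w'.
Proof.
move=> q0 ww' psiE.
have kapE m : forall i : 'I_r, (i < m)%N -> w (kap i) = w' (kap i).
  elim: m => // m IHm i; rewrite ltnS leq_eqVlt => /predU1P[im|/IHm//].
  (* [w1] agrees with [w'] on everything server [s i] sees, and with [w] off [kap i]. *)
  pose w1 : msgs F K L := [ffun k => if k == kap i then w' k else w k].
  suff: w = w1 by move=> ->; rewrite ffunE eqxx.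
  apply: (@psi_inj (kap i) (s i) _ _ q) => // [j /negbTE jk|].
    by rewrite ffunE jk.
  rewrite psiE; case: wfS => _ _ _; apply=> k ks; rewrite ffunE.
  have [//|kki] := eqVneq k (kap i).
  have [/codomP[j kj]|/ww' //] := boolP (k \in codom kap).
  rewrite kj in ks kki *; apply/esym/IHm; rewrite -im ltn_neqAle.
  rewrite (contra_neq _ kki) => [|/val_inj-> //]; rewrite leqNgt.
  by apply: contraL ks => /kap_out.
apply/ffunP => k; have [/codomP[j ->]|/ww' //] := boolP (k \in codom kap).
exact: kapE (ltn_ord j).
Qed.

Lemma card_XA_fiber (q : QT S) x : 0 < pQ q ->
  (#|[set w : msgs F K L | XA setT ((w, q) : Omega S) == x]| * #|F| ^ (r * L)
     <= #|F| ^ (K * L))%N.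
Proof.
move=> q0; set E := [set w | _].
have <- : #|[set: {ffun 'I_r -> 'rV[F]_L}]| = (#|F| ^ (r * L))%N.
  by rewrite cardsT card_ffun card_mx card_ord mul1n -expnM mulnC.
rewrite -cardsX -(card_msgs F K L).
(* Overwrite the chain coordinates of a fiber element by arbitrary values. This is injective because
   inside a fiber the other coordinates determine the tuple. *)
pose f (p : msgs F K L * {ffun 'I_r -> 'rV[F]_L}) : msgs F K L :=
  [ffun k => if [pick i | kap i == k] is Some i then p.2 i else p.1 k].
have fk p i : f p (kap i) = p.2 i.
  rewrite ffunE; case: pickP => [j /eqP/kap_inj-> //|/(_ i)].
  by rewrite eqxx.
have fN p k : k \notin codom kap -> f p k = p.1 k.
  move=> kN; rewrite ffunE; case: pickP => // j /eqP jk.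
  by rewrite -jk codom_f in kN.
rewrite -(card_in_imset (f := f)) ?max_card // => -[w v] [w' v'].
rewrite !inE /= !andbT => /eqP wx /eqP w'x ff'; congr (_, _).
  apply: (psi_chain_inj q0) => [k kN|n].
    by have /ffunP/(_ k) := ff'; rewrite !fN.
  have /XA_eqP/(_ n) := etrans wx (esym w'x).
  by apply; rewrite inE.
by apply/ffunP => i; have /ffunP/(_ (kap i)) := ff'; rewrite !fk.
Qed.

Lemma PrE_XA_le (x : {ffun 'I_N -> seq F}) :
  PrE (@XA _ _ _ _ _ S setT) x <= 1 / #|F|%:R ^+ (r * L).
Proof.
case: wfS => pge0 psum1 _ _; rewrite PrE_fiber -[X in _ <= X / _]psum1 mulr_suml.
apply: ler_sum => q _.
case: (ltrgtP 0 (pQ q)) (pge0 q) => // [q0|<-] _; last by rewrite !mul0r.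
rewrite -mulrA ler_pM2l // ler_pdivrMr ?exprn_gt0 ?card_F_gt0 //.
rewrite [leRHS]mulrC ler_pdivlMr ?exprn_gt0 ?card_F_gt0 //.
by rewrite -!natrX -natrM ler_nat card_XA_fiber.
Qed.

(* Security gives H(W) + H(X, Wsum) = H(W, X, Wsum) + H(Wsum), where
   (W, X, Wsum) is a function of (W, Q). *)
Lemma rand_size_ge : (0 < K)%N -> (0 < r)%N -> secure_cond S -> (r - 1)%:R <= rand_size S.
Proof.
move=> K0 r0 secS; case: wfS => pge0 psum1 _ _.
rewrite /rand_size ler_pdivlMr ?ltr0n // natrB // mulrBl mul1r -natrM.
have XS : (r * L)%:R <= H (pairRV (@XA _ _ _ _ _ S setT) (@Wsum _ _ _ _ _ S)).
  apply: H_ge => // w _; apply: le_trans (PrE_XA_le (XA setT w)).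
  by apply: PrE_le_sub => // w' [].
have WS : H (@Wall _ _ _ _ _ S) <= H (pairRV (@Wall _ _ _ _ _ S) (@Wsum _ _ _ _ _ S)).
  by apply: H_le_sub => // w w' [].
have WXS : H (pairRV (pairRV (@Wall _ _ _ _ _ S) (XA setT)) (@Wsum _ _ _ _ _ S)) <= H (@id (Omega S)).
  by apply: H_le_sub => // w w' ->.
move: secS; rewrite /secure_cond /Icond H_Wsum // => /eqP.
rewrite subr_eq0 subr_eq => /eqP sec.
rewrite (H_Wall pge0 psum1) in WS; rewrite (H_msgs_Q pge0 psum1) in WXS.
rewrite lerBlDr -(lerD2l (K * L)%:R) addrA.
by apply: le_trans (lerD WS XS) _; rewrite sec [leRHS]addrC lerD2l.
Qed.

End Chain.
End Converse.

(** * The Lagrange scheme *)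

Section Lagrange.
Variables (F : fieldType) (I : finType) (alpha : I -> F).
Hypothesis alpha_inj : injective alpha.

Definition lagrange_poly (T : {set I}) (i : I) : {poly F} :=
  (\prod_(j <- enum (T :\ i)) (alpha i - alpha j))^-1 *:
    \prod_(j <- enum (T :\ i)) ('X - (alpha j)%:P).

Lemma size_lagrange_poly (T : {set I}) i :
  i \in T -> (size (lagrange_poly T i) <= #|T|)%N.
Proof.
move=> iT; apply: leq_trans (size_scale_leq _ _) _.
by rewrite size_prod_XsubC -cardE [#|T|](cardsD1 i) iT.
Qed.

Lemma lagrange_poly_eval (T : {set I}) i j :
  j \in T -> (lagrange_poly T i).[alpha j] = (i == j)%:R.
Proof.
move=> jT; rewrite hornerZ horner_prod.
under [X in _ * X]eq_bigr do rewrite hornerXsubC.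
have [<-|ij] := eqVneq i j.
  rewrite mulVf // prodf_seq_neq0; apply/allP => k.
  by rewrite mem_enum !inE subr_eq0 => /andP[ki _]; rewrite (inj_eq alpha_inj) eq_sym.
apply/eqP; rewrite mulf_eq0 prodf_seq_eq0; apply/orP; right.
by apply/hasP; exists j; [rewrite mem_enum !inE eq_sym ij | rewrite /= subrr].
Qed.

(** The difference of the two sides has size at most |T| but vanishes at |T| distinct points. *)
Lemma lagrange_interp (T : {set I}) (p : {poly F}) : (size p <= #|T|)%N ->
  p = \sum_(i in T) p.[alpha i] *: lagrange_poly T i.
Proof.
move=> sp; apply/eqP; rewrite -subr_eq0; apply/negPn/negP; set e := _ - _ => e0.
have rt : all (root e) [seq alpha i | i <- enum T].
  apply/allP => _ /mapP[j + ->]; rewrite mem_enum => jT.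
  rewrite rootE hornerD hornerN horner_sum (bigD1 j) //= hornerZ.
  rewrite lagrange_poly_eval // eqxx mulr1 big1 ?addr0 ?subrr // => k /andP[_ kj].
  by rewrite hornerZ lagrange_poly_eval // (negbTE kj) mulr0.
have := max_poly_roots e0 rt; rewrite map_inj_uniq // enum_uniq => /(_ isT).
rewrite size_map -cardE ltnNge => /negP; apply.
apply: leq_trans (size_polyD _ _) _; rewrite geq_max sp size_polyN.
apply: leq_trans (size_sum _ _ _) _.
apply/bigmax_leqP => i iT; apply: leq_trans (size_scale_leq _ _) _.
exact: size_lagrange_poly.
Qed.

Lemma sum_lagrange_eval (T : {set I}) j x : (j < #|T|)%N ->
  \sum_(i in T) alpha i ^+ j * (lagrange_poly T i).[x] = x ^+ j.
Proof.
move=> jT; have := @lagrange_interp T 'X^j; rewrite size_polyXn => /(_ jT).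
move=> /(congr1 (fun p => p.[x])); rewrite hornerXn horner_sum => ->.
by apply: eq_bigr => i _; rewrite hornerZ hornerXn.
Qed.

Lemma sum_lagrange_coef (T : {set I}) j m : (j < #|T|)%N ->
  \sum_(i in T) alpha i ^+ j * (lagrange_poly T i)`_m = (j == m)%:R.
Proof.
move=> jT; have := @lagrange_interp T 'X^j; rewrite size_polyXn => /(_ jT).
move=> /(congr1 (fun p : {poly F} => p`_m)); rewrite coefXn coef_sum eq_sym => ->.
by apply: eq_bigr => i _; rewrite coefZ hornerXn.
Qed.

(* MDS property: any m columns of an m-row Vandermonde matrix are independent. *)
Lemma moments_eq0 (V : lmodType F) (T : {set I}) (m : nat) (x : I -> V) :
  (#|T| <= m)%N -> (forall i, i \notin T -> x i = 0) ->
  (forall j, (j < m)%N -> \sum_i alpha i ^+ j *: x i = 0) ->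
  forall i, x i = 0.
Proof.
move=> Tm xT mom i; have [iT|/xT//] := boolP (i \in T).
have /horner_coef_wide hE := leq_trans (size_lagrange_poly iT) Tm.
have <- : \sum_k (lagrange_poly T i).[alpha k] *: x k = x i.
  rewrite (bigD1 i) //= lagrange_poly_eval // eqxx scale1r big1 ?addr0 // => k ki.
  have [kT|/xT->] := boolP (k \in T); last by rewrite scaler0.
  by rewrite lagrange_poly_eval // eq_sym (negbTE ki) scale0r.
under eq_bigr do rewrite hE scaler_suml.
rewrite exchange_big big1 //= => j _.
under eq_bigr do rewrite -scalerA.
by rewrite -scaler_sumr mom // scaler0.
Qed.

End Lagrange.

(** * Encoders, decodability and security of the scheme *)

Section Achievability.
Variables (R : realType) (F : finFieldType) (K L d r : nat).
Let N := (d.+1 + r)%N.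
Variables (alpha : 'I_N -> F) (Z : 'I_N -> {set 'I_K}).
Hypothesis alpha_inj : injective alpha.
Hypothesis card_Z : forall k, #|[set n | k \in Z n]| = d.+1.

(** On d + 1 nodes the coefficient of X^d is the leading one, the inverse of the product of the node
    differences: the divided-difference weight. *)
Definition enc_coef (n : 'I_N) (k : 'I_K) : F :=
  if k \in Z n then (lagrange_poly alpha [set m | k \in Z m] n)`_d else 0.

Definition head_servers : {set 'I_N} := [set lshift r i | i in 'I_d.+1].

(* The tail of the noise is the free randomness; the head is chosen so that
   all moments of order at most d vanish. *)
Definition noise (q : msgs F r L) (n : 'I_N) : 'rV[F]_L :=
  match split n with
  | inl i => - \sum_m (lagrange_poly alpha head_servers (lshift r i)).[alpha (rshift d.+1 m)] *: q m
  | inr m => q m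
  end.

Definition enc (n : 'I_N) (w : msgs F K L) (q : msgs F r L) : 'rV[F]_L :=
  \sum_k enc_coef n k *: w k + noise q n.

(** Interpolating X^j at the d + 1 head points is exact at each tail point, so the head cancels the
    tail. *)
Lemma noise_moment q j : (j <= d)%N -> \sum_n alpha n ^+ j *: noise q n = 0.
Proof.
move=> jd; rewrite big_split_ord /=.
have noiseL i : noise q (lshift r i) = - \sum_m
    (lagrange_poly alpha head_servers (lshift r i)).[alpha (rshift d.+1 m)] *: q m.
  by rewrite /noise (unsplitK (inl _ i)).
have noiseR m : noise q (rshift d.+1 m) = q m by rewrite /noise (unsplitK (inr _ m)).
under eq_bigr do rewrite noiseL scalerN scaler_sumr.
under [X in _ + X]eq_bigr do rewrite noiseR.
rewrite sumrN exchange_big -sumrN -big_split big1 //= => m _.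
under eq_bigr do rewrite scalerA.
rewrite -scaler_suml -(big_imset (fun n => alpha n ^+ j *
  (lagrange_poly alpha head_servers n).[alpha (rshift d.+1 m)])) /=; last first.
  by move=> i1 i2 _ _; apply: lshift_inj.
rewrite sum_lagrange_eval ?addNr // card_imset ?card_ord //; exact: lshift_inj.
Qed.

Lemma enc_moment w q j : (j <= d)%N ->
  \sum_n alpha n ^+ j *: enc n w q = (j == d)%:R *: \sum_k w k.
Proof.
move=> jd; under eq_bigr do rewrite scalerDr scaler_sumr.
rewrite big_split /= noise_moment // addr0 exchange_big scaler_sumr.
apply: eq_bigr => k _; under eq_bigr do rewrite scalerA.
rewrite -scaler_suml; congr (_ *: _).
rewrite -(sum_lagrange_coef alpha_inj (T := [set m | k \in Z m])) ?card_Z //.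
rewrite [RHS]big_mkcond; apply: eq_bigr => n _.
by rewrite /enc_coef inE; case: ifP => // _; rewrite mulr0.
Qed.

Lemma enc_eq_sum (w w' : msgs F K L) (q q' : msgs F r L) :
  (forall n, enc n w q = enc n w' q') -> \sum_k w k = \sum_k w' k.
Proof.
move=> eqw; have := enc_moment w' q' (leqnn d).
under eq_bigr do rewrite -eqw.
by rewrite enc_moment // eqxx !scale1r.
Qed.

(** The difference of the answer vectors is supported off T and has m vanishing moments; the d-th is
    among them only when m = d + 1, where equal sums are required. *)
Lemma enc_determined (T : {set 'I_N}) m (w w' : msgs F K L) (q q' : msgs F r L) :
  (#|~: T| <= m <= d.+1)%N -> (m = d.+1 -> \sum_k w k = \sum_k w' k) ->
  {in T, forall n, enc n w q = enc n w' q'} ->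
  forall n, enc n w q = enc n w' q'.
Proof.
move=> /andP[Tm md] sumE encT n; apply/eqP; rewrite -subr_eq0; apply/eqP.
apply: (@moments_eq0 _ _ _ alpha_inj _ (~: T) m (fun n => enc n w q - enc n w' q')) => //.
  by move=> i; rewrite inE negbK => /encT ->; rewrite subrr.
move=> j jm; under eq_bigr do rewrite scalerBr.
have jd : (j <= d)%N by rewrite -ltnS (leq_trans jm).
rewrite sumrB !enc_moment // -scalerBr.
have [jd'|] := eqVneq j d; last by rewrite scale0r.
by rewrite sumE ?subrr ?scaler0 //; apply/eqP; rewrite eqn_leq md -jd'.
Qed.

Definition lagrange_scheme : scheme R F K N L :=
  @Scheme R F K N L (msgs F r L) (fun=> 1 / #|F|%:R ^+ (r * L)) Z (fun=> L) enc.

Notation S := lagrange_scheme.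

Lemma lagrange_pQ_ge0 (q : QT S) : 0 <= pQ q.
Proof. by rewrite divr_ge0 ?exprn_ge0 ?ler0n. Qed.

Lemma lagrange_pQ_sum1 : \sum_(q : QT S) pQ q = 1.
Proof.
rewrite /= sumr_const card_msgs -[LHS]mulr_natr natrX -mulrA mul1r mulVf //.
exact: cardF_expn_neq0.
Qed.
#[local] Hint Resolve lagrange_pQ_ge0 lagrange_pQ_sum1 : core.

Lemma lagrange_well_formed M :
  (forall n, #|Z n| <= M)%N -> well_formed S M.
Proof.
move=> ZM; split=> // n w w' q ww' /=; congr (_ + _); apply: eq_bigr => k _.
by rewrite /enc_coef; case: ifP => [/ww' ->|]; rewrite ?scale0r.
Qed.

Lemma lagrange_decodable : decodable S r.+1.
Proof.
move=> A cA; apply/eqP; rewrite subr_eq0; apply/eqP.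
apply: H_equiv => // w w'; split=> [eqA|[] //]; congr (_, _) => //.
have {eqA}/XA_eqP eqA := eqA; apply: (enc_eq_sum (q := w'.2) (q' := w.2)).
(* Only d answers are missing, so moments below d suffice and the sum need not be known. *)
apply: (enc_determined (m := d) _ _ eqA); last by move=> /eqP; rewrite ltn_eqF.
by rewrite leqnSn andbT cardsCs setCK cA card_ord /N addSnnS addnK.
Qed.

(** The answers masked directly by the free noise; with the sum they carry the same information as
    all answers. *)
Definition tail_enc (w : Omega S) : msgs F r L :=
  [ffun m => enc (rshift d.+1 m) w.1 w.2].

Lemma tail_encE (w : Omega S) m :
  tail_enc w m = \sum_k enc_coef (rshift d.+1 m) k *: w.1 k + w.2 m.
Proof. by rewrite ffunE /enc /noise (unsplitK (inr _ m)). Qed.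

Lemma PrE_sum_tail (K0 : (0 < K)%N) (x : 'rV[F]_L * msgs F r L) :
  PrE (pairRV (@Wsum _ _ _ _ _ S) tail_enc) x = 1 / #|F|%:R ^+ (r.+1 * L).
Proof.
case: x => s b; rewrite /PrE /Prob /= sumr_const.
(* For each w exactly one q yields the tail b, so the event is counted by the tuples with sum s. *)
pose g (w : msgs F K L) : Omega S :=
  (w, [ffun m => b m - \sum_k enc_coef (rshift d.+1 m) k *: w k]).
have g_inj : injective g by move=> w w' [].
have -> : #|[pred w : Omega S | pairRV (@Wsum _ _ _ _ _ S) tail_enc w == (s, b)]|
   = (#|F| ^ (K.-1 * L))%N.
  rewrite -(card_sum_fiber s K0) -(card_imset _ g_inj).
  apply: eq_card => -[w q]; rewrite inE /=; apply/eqP/imsetP => [[ws wb]|[w' + ->]].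
    exists w; first by rewrite inE; apply/eqP.
    congr (_, _); apply/ffunP => m.
    by rewrite ffunE -wb tail_encE /= addrAC subrr add0r.
  rewrite inE => /eqP ws; congr (_, _) => //.
  by apply/ffunP => m; rewrite tail_encE /= ffunE addrC subrK.
rewrite -[LHS]mulr_natr natrX !mul1r -{1}(prednK K0) !mulSn !exprD.
rewrite !invfM; have nz m := cardF_expn_neq0 R F m.
rewrite -!mulrA mulVf // mulr1 mulrC //.
Qed.

Lemma lagrange_H_Q : H (@Qrv _ _ _ _ _ S) = (r * L)%:R.
Proof. by apply: H_unif => // q; rewrite PrE_Qrv. Qed.

Lemma lagrange_secure : (0 < K)%N -> secure_cond S.
Proof.
move=> K0; rewrite /secure_cond /Icond.
have -> : H (pairRV (@Wall _ _ _ _ _ S) (@Wsum _ _ _ _ _ S)) = H (@Wall _ _ _ _ _ S).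
  apply: H_equiv => // w w'; split=> [|[] //]; rewrite /Wall /pairRV /Wsum.
  by move=> ->.
have -> : H (pairRV (@XA _ _ _ _ _ S setT) (@Wsum _ _ _ _ _ S))
    = H (pairRV (@Wsum _ _ _ _ _ S) tail_enc).
  apply: H_equiv => // w w'; split=> [[ws wt]|[/XA_eqP wx ws]].
    congr (_, _) => //; apply/XA_eqP => n _ /=.
    (* Here d + 1 answers are missing, and the known sum supplies the extra moment. *)
    apply: (@enc_determined [set rshift d.+1 m | m in 'I_r] d.+1) => //.
      rewrite leqnn andbT cardsCs setCK card_imset ?card_ord ?addnK //.
      exact: rshift_inj.
    by move=> _ /imsetP[m _ ->]; have /ffunP/(_ m) := wt; rewrite !ffunE.
  by congr (_, _) => //; apply/ffunP => m; rewrite !ffunE; apply: wx.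
have -> : H (pairRV (pairRV (@Wall _ _ _ _ _ S) (XA setT)) (@Wsum _ _ _ _ _ S))
    = H (@id (Omega S)).
  apply: H_equiv => // -[w q] [w' q']; split=> [-> //|[ww' /XA_eqP wx _]].
  rewrite /Wall /= in ww' wx; rewrite ww' in wx *; congr (_, _).
  (* Given W, the tail answers reveal the noise, so (W, X) determines (W, Q). *)
  apply/ffunP => m; have := wx (rshift d.+1 m); rewrite inE => /(_ isT).
  by rewrite /enc /noise (unsplitK (inr _ m)) => /addrI.
rewrite H_msgs_Q // H_Wall // H_Wsum // lagrange_H_Q.
rewrite (@H_unif _ _ _ _ _ _ _ _ _ _ (r.+1 * L)) // => [|w]; last exact: PrE_sum_tail.
by rewrite mulSn natrD -addrA -opprD [_ + L%:R]addrC addrCA subrr.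
Qed.

Lemma lagrange_rand_size : (0 < L)%N -> rand_size S = r%:R.
Proof.
move=> L0; rewrite /rand_size lagrange_H_Q natrM mulfK //.
by rewrite pnatr_eq0 -lt0n.
Qed.

Lemma lagrange_comm_cost_le Nr : (0 < L)%N -> comm_cost S Nr <= Nr%:R.
Proof.
move=> L0; rewrite ler_pdivrMr ?ltr0n // -natrM ler_nat.
by apply/bigmax_leqP => A /eqP cA; rewrite sum_nat_const cA.
Qed.

End Achievability.

(** * Cyclic assignment *)

Lemma Mod_eq (a b n : nat) : (0 < n)%N -> (Mod a n == Mod b n) = (a == b %[mod n]).
Proof.
move=> n0; rewrite /Mod /dvdn.
have [a0|a0] := eqVneq (a %% n)%N 0%N; have [b0|b0] := eqVneq (b %% n)%N 0%N.
- by rewrite a0 b0 !eqxx.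
- by rewrite a0 gtn_eqF ?ltn_pmod // eq_sym (negbTE b0).
- by rewrite b0 ltn_eqF ?ltn_pmod // (negbTE a0).
- by [].
Qed.

(** The one-based shifts of message and server cancel in the congruence. *)
Lemma mem_cyclic K N Nr (n : 'I_N) (k : 'I_K) :
  (k \in cyclic_assignment K Nr n) =
  [exists j : 'I_(N - Nr).+1, k == n + j %[mod N]].
Proof.
have N0 : (0 < N)%N by apply: leq_trans (ltn_ord n).
rewrite inE; apply: eq_existsb => j.
by rewrite Mod_eq // addSn -[k.+1]addn1 -[(n + j).+1]addn1 eqn_modDr.
Qed.

Lemma card_cyclic_servers K N Nr (k : 'I_K) : (0 < Nr)%N -> (Nr <= N)%N ->
  #|[set n : 'I_N | k \in cyclic_assignment K Nr n]| = (N - Nr).+1.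
Proof.
move=> Nr0 leNr; have N0 : (0 < N)%N by apply: leq_trans leNr.
have ltN (j : 'I_(N - Nr).+1) : (j < N)%N.
  by rewrite (leq_trans (ltn_ord j)) // -subSn // leq_subLR -addn1 addnC leq_add2r.
(* The server k - j modulo N, written with N - j to avoid truncated subtraction. *)
pose f (j : 'I_(N - Nr).+1) : 'I_N := Ordinal (ltn_pmod (k + (N - j)) N0).
have fE j : f j + j = k %[mod N].
  by rewrite modnDml -addnA subnK 1?ltnW // modnDr.
have f_inj : injective f.
  move=> i j eqf; apply/val_inj => /=; have := fE i; rewrite eqf -(fE j) => /eqP.
  by rewrite eqn_modDl !modn_small // => /eqP.
rewrite -[RHS]card_ord -(card_imset _ f_inj); apply: eq_card => n.
rewrite inE mem_cyclic; apply/existsP/imsetP => [[j /eqP kj]|[j _ ->]]; exists j => //.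
  apply/val_inj; rewrite /= -(modn_small (ltn_ord n)); apply/eqP.
  rewrite -(eqn_modDr j) -addnA subnK 1?ltnW //.
  by rewrite modnDr kj.
by rewrite fE.
Qed.

Lemma card_cyclic_le K N Nr (n : 'I_N) : (N %| K)%N ->
  (#|cyclic_assignment K Nr n| <= K %/ N * (N - Nr + 1))%N.
Proof.
move=> NK; have N0 : (0 < N)%N by apply: leq_trans (ltn_ord n).
have [K0|] := posnP K.
  by rewrite (leq_trans (max_card _)) // card_ord K0.
move=> K0.
(* A held message is given by its block of N consecutive indices and its offset in the cyclic
   window. *)
pose f (p : 'I_(K %/ N) * 'I_(N - Nr).+1) : 'I_K :=
  insubd (Ordinal K0) (p.1 * N + (n + p.2) %% N)%N.
rewrite -[(K %/ N)%N]card_ord addn1 -[(N - Nr).+1]card_ord -card_prod.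
rewrite -cardsT; apply: leq_trans (leq_imset_card f _); apply/subset_leq_card.
apply/subsetP => k; rewrite mem_cyclic => /existsP[j /eqP kj]; apply/imsetP.
have kN : (k %/ N < K %/ N)%N by rewrite ltn_divLR // divnK.
exists (Ordinal kN, j) => //; apply/val_inj; rewrite /f /= -kj -divn_eq.
by rewrite insubdK ?ltn_ord // /in_mem /= ltn_ord.
Qed.

Theorem theorem5 (R : realType) (K N Nr L : nat) :
  (0 < K)%N -> (0 < N)%N -> (0 < Nr)%N -> (Nr <= N)%N -> (N %| K)%N ->
  (0 < L)%N ->
  exists q0 : nat, forall F : finFieldType, (q0 <= #|F|)%N ->
    let M := (K %/ N * (N - Nr + 1))%N in
    (exists S : scheme R F K N L,
        uses_cyclic Nr S /\ optimal_secure M Nr S /\ rand_size S = (Nr - 1)%:R) /\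
    (forall S : scheme R F K N L,
        uses_cyclic Nr S -> optimal_secure M Nr S -> (Nr - 1)%:R <= rand_size S).
Proof.
(* The field must supply N distinct evaluation points. *)
move=> K0 N0 Nr0 leNr NK L0; exists N => F leF M.
have NleK : (N <= K)%N by exact: dvdn_leq.
have tightM : (K * (N - Nr).+1 = N * M)%N by rewrite /M addn1 mulnA [(N * _)%N]mulnC divnK.
have M0 : (0 < M)%N by rewrite /M muln_gt0 divn_gt0 // NleK addn1.
split; last first.
  move=> S cycS [[wfS decS secS] _].
  (* Chain: message N - N_r + i is the last in the window of server i (zero-based), beyond the
     windows of earlier servers; being below N, it involves no wraparound. *)
  have kN (i : 'I_Nr) : (N - Nr + i < N)%N.
    by rewrite -{2}(subnK leNr) ltn_add2l.
  have kK (i : 'I_Nr) : (N - Nr + i < K)%N by apply: leq_trans (kN i) NleK.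
  pose s (i : 'I_Nr) := widen_ord leNr i; pose kap i := Ordinal (kK i).
  apply: (rand_size_ge wfS decS leNr L0 Nr0 tightM (s := s) (kap := kap)) => //.
    move=> i; rewrite cycS mem_cyclic; apply/existsP; exists ord_max.
    by rewrite /= addnC.
  move=> i j ltji; rewrite cycS mem_cyclic; apply/existsPn => t /=.
  have tj : (j + t < N - Nr + i)%N.
    by rewrite addnC -addnS leq_add // -ltnS.
  by rewrite !modn_small ?kN ?gtn_eqF // (ltn_trans tj).
have [d [r [eN eNr]]] : exists d r, N = (d.+1 + r)%N /\ Nr = r.+1.
  by exists (N - Nr)%N, Nr.-1; rewrite addSnnS prednK ?subnK.
have dE : (N - Nr = d)%N by rewrite eN eNr addSnnS addnK.
have cS k : #|[set n : 'I_N | k \in cyclic_assignment K Nr n]| = d.+1.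
  by rewrite card_cyclic_servers // dE.
have cZ n : (#|@cyclic_assignment K N Nr n| <= M)%N by exact: card_cyclic_le.
pose alpha (n : 'I_N) : F := enum_val (widen_ord leF n).
have alpha_inj : injective alpha.
  by move=> i j /enum_val_inj eq_ij; apply/val_inj; exact: (congr1 val eq_ij).
clearbody alpha; subst N.
pose S := lagrange_scheme R L alpha (@cyclic_assignment K (d.+1 + r) Nr).
exists S; split=> //; split; last by rewrite lagrange_rand_size // eNr subn1.
split.
  split; [exact: lagrange_well_formed | rewrite eNr | exact: lagrange_secure].
  exact: lagrange_decodable.
(* The converse bounds the cost of every secure scheme, whatever its assignment, so cost N_r is
   optimal. *)
move=> S' [wf' dec' _]; apply: le_trans (lagrange_comm_cost_le _ _ _ _ L0) _.
exact: (comm_cost_ge wf' dec' leNr L0 Nr0 tightM M0).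
Qed.
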